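(* Let $B$ be a simple Bratteli diagram and $G$ its dimension group. Suppose that there is an order $\omega\in\mathcal P_B^*\setminus\bigcup_{j=1}^\infty\mathcal O_B(j)$ on $B$. Then the infinitesimal subgroup $\mathrm{Inf}(G)$ of $G$ contains as a subgroup the free abelian group on countably (infinitely) many generators.
   Context: A Bratteli diagram $B=(V,E)$ is an infinite graph with $V=\bigsqcup_{i\ge 0}V_i$, $E=\bigsqcup_{i\ge 1}E_i$, all $V_i,E_i$ finite, $V_0=\{v_0\}$, and range and source maps $r,s:E\to V$ with $r(E_i)=V_i$, $s(E_i)=V_{i-1}$, $s^{-1}(v)\ne\emptyset$ for all $v\in V$, $r^{-1}(v)\neq\emptyset$ for all $v\in V\setminus V_0$. A path is a sequence of edges with $r(e_i)=s(e_{i+1})$. $X_B$ is the space of infinite paths starting at $v_0$, with the topology generated by cylinder sets. The incidence matrix $F_n=(f^{(n)}_{v,w})_{v\in V_{n+1},w\in V_n}$, $n\ge0$, has $f^{(n)}_{v,w}=|\{e\in E_{n+1}: r(e)=v,s(e)=w\}|$. $B$ is simple if for every $n$ there is $m>n$ such that every $v\in V_n$ and $w\in V_m$ are joined by a path. For $x\in X_B$ and $n\ge1$, $v_n(x)$ is the vertex of $V_n$ that $x$ passes through. An order $\omega$ on $B$ is a choice of linear order on each $r^{-1}(v)$, $v\in V\setminus V_0$. It induces an order on finite paths between levels $k<l$ with the same range: $(e_{k+1},\dots,e_l)>(f_{k+1},\dots,f_l)$ iff for some $i$, $e_j=f_j$ for $i<j\le l$ and $e_i>f_i$. A path is maximal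 (minimal) if each of its edges $e_i$ is maximal (minimal) in $r^{-1}(r(e_i))$; $X_{\max}(\omega),X_{\min}(\omega)$ are the sets of maximal and minimal infinite paths in $X_B$. $\mathcal O_B(j)$ is the set of orders $\omega$ on $B$ with $|X_{\max}(\omega)|=|X_{\min}(\omega)|=j$. For $v\in V\setminus V_0$, $\widetilde e_v,\overline e_v$ are the maximal and minimal edges in $r^{-1}(v)$. Standing assumptions: $X_B$ has no isolated points; $B$ is aperiodic (every tail equivalence class in $X_B$, where $x\sim y$ iff $x_n=y_n$ for all large $n$, is infinite); $B$ is regular (for every order $\omega$ on $B$, $X_{\max}(\omega)$ and $X_{\min}(\omega)$ have empty interior). A Vershik map for $\omega$ is a homeomorphism $\varphi_\omega:X_B\to X_B$ with $\varphi_\omega(X_{\max}(\omega))=X_{\min}(\omega)$ and, for $x\notin X_{\max}(\omega)$, $\varphi_\omega(x)=(x_1^0,\dots,x_{k-1}^0,\overline{x_k},x_{k+1},\dots)$, where $k$ is least with $x_k$ not maximal, $\overline{x_k}$ is the successor of $x_k$ in $r^{-1}(r(x_k))$ and $(x_1^0,\dots,x_{k-1}^0)$ is the minimal path from $v_0$ to $s(\overline{x_k})$. $\omega$ is perfect if it admits a Vershik map. Let $\widetilde V_n=\{v_n(M):M\in X_{\max}(\omega)\}$, $\overline V_n=\{v_n(m):m\in X_{\min}(\omega)\}$. $(B,\omega)$ is well telescoped if for each $n\ge1$ and $v\in V_{n+1}$, $s(\widetilde e_v)\in\widetilde V_n$ and $s(\overline e_v)\in\overline V_n$, and all nonzero incidence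 matrix entries are at least two. For $v\in V_N$ and $n<N$ list all paths from $V_n$ to $v$ in increasing order as $e_1<\dots<e_p$ and put $w(v,n,N)=s(e_1)\cdots s(e_p)$; $\mathcal L(B,\omega,n)$ is the set of subwords of all such words with $N>n$. Define $\sigma_n:\widetilde V_n\to2^{\overline V_n}$ by $\overline v\in\sigma_n(\widetilde v)$ iff $\widetilde v\,\overline v\in\mathcal L(B,\omega,n)$, and $\sigma_n^{-1}(\overline v)=\{\widetilde v:\overline v\in\sigma_n(\widetilde v)\}$. $\mathcal P_B^*$ is the set of perfect orders $\omega$ on $B$, with $(B,\omega)$ well telescoped, such that for each maximal path $M$ the set $\sigma_n(v_n(M))$ is a singleton for all sufficiently large $n$, and for each minimal path $m$ the set $\sigma_n^{-1}(v_n(m))$ is a singleton for all sufficiently large $n$. The dimension group of $B$ is the (ordered) direct limit $G=\varinjlim(\mathbb Z^{|V_n|}\xrightarrow{F_n}\mathbb Z^{|V_{n+1}|})$, each $\mathbb Z^{|V_n|}$ having the coordinatewise order, with order unit the class of $1\in\mathbb Z^{|V_0|}=\mathbb Z$. A normalized trace on $G$ is a positive homomorphism $\tau:G\to\mathbb R$ taking the value $1$ on the order unit (equivalently, it is given by a probability measure on $X_B$ invariant under tail equivalence). $\mathrm{Inf}(G)=\{g\in G:\tau(g)=0\text{ for every normalized trace }\tau\text{ on }G\}$. *)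

(* Defs.v *)
From HB Require Import structures.
From mathcomp Require Import all_boot all_order all_algebra.
From mathcomp Require Import generic_quotient.
From mathcomp Require Import all_classical all_reals all_analysis.
From mathcomp Require Import freeg.

Set Implicit Arguments.
Unset Strict Implicit.
Unset Printing Implicit Defensive.

Import Order.TTheory GRing.Theory Num.Theory.
Local Open Scope classical_set_scope.
Local Open Scope quotient_scope.
Local Open Scope ring_scope.

(* [E B n] is the set of edges between the levels [n] and [n.+1], usually
   written E_{n+1}. *)
Record bratteli := Bratteli {
  V : nat -> finType;
  E : nat -> finType;
  src : forall n, E n -> V n;
  rng : forall n, E n -> V n.+1;
  card_V0 : #|V 0| = 1%N;
  src_surj : forall n (v : V n), exists e, src e = v;
  rng_surj : forall n (v : V n.+1), exists e, rng e = v }.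

Definition incid (B : bratteli) n (v : V B n.+1) (w : V B n) : nat :=
  #|[pred e : E B n | (rng e == v) && (src e == w)]|.

(* Finite paths, as sequences of edges of the whole diagram *)

Definition vertex (B : bratteli) := {n : nat & V B n}.
Definition edge (B : bratteli) := {n : nat & E B n}.

HB.instance Definition _ B := Choice.copy (vertex B) {n : nat & V B n}.
HB.instance Definition _ B := Choice.copy (edge B) {n : nat & E B n}.

Definition vtx (B : bratteli) n (v : V B n) : vertex B := Tagged (V B) v.
Definition edg (B : bratteli) n (e : E B n) : edge B := Tagged (E B) e.
Definition esrc (B : bratteli) (e : edge B) : vertex B := vtx (src (tagged e)).
Definition erng (B : bratteli) (e : edge B) : vertex B := vtx (rng (tagged e)).

(* [joins u p v]: [p] is a path from [u] to [v].  The empty sequence is the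
   path of length 0. *)
Fixpoint joins (B : bratteli) (u : vertex B) (p : seq (edge B))
    (v : vertex B) : bool :=
  if p is e :: p' then (esrc e == u) && joins (erng e) p' v else u == v.

Definition simple_bratteli (B : bratteli) : Prop :=
  forall n, exists2 m, (n < m)%N &
    forall (v : V B n) (w : V B m), exists p, joins (vtx v) p (vtx w).

(* The path space; every edge in [E B 0] starts at the unique vertex of
    [V B 0] *)

Record infpath (B : bratteli) := InfPath {
  pth :> forall n, E B n;
  pth_chain : forall n, rng (pth n) = src (pth n.+1) }.

HB.instance Definition _ B := gen_eqMixin (infpath B).
HB.instance Definition _ B := gen_choiceMixin (infpath B).

Definition cylinder (B : bratteli) (x : infpath B) n : set (infpath B) :=
  [set y | forall i, (i < n)%N -> y i = x i].

Definition cylinders (B : bratteli) : set (set (infpath B)) :=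
  [set A | exists x n, A = cylinder x n].

Lemma cylinders_cover (B : bratteli) :
  \bigcup_(A in @cylinders B) id A = [set: infpath B].
Proof.
by apply/seteqP; split=> x // _; exists (cylinder x 0) => //; exists x, 0%N.
Qed.

Lemma cylinders_join (B : bratteli) (C D : set (infpath B)) t :
  cylinders C -> cylinders D -> id C t -> id D t ->
  exists A, [/\ cylinders A, id A t & id A `<=` id C `&` id D].
Proof.
move=> [x [n ->]] [y [m ->]] xt yt; exists (cylinder t (maxn n m)).
split=> [|//|z zt]; first by exists t, (maxn n m).
by split=> i im; [rewrite -xt//|rewrite -yt//]; apply: zt; rewrite leq_max im ?orbT.
Qed.

HB.instance Definition _ B := isBaseTopological.Build (infpath B)
  (@cylinders_cover B) (@cylinders_join B).

Definition tail_equiv (B : bratteli) (x y : infpath B) : Prop :=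
  \forall n \near \oo, x n = y n.

Definition no_isolated_path (B : bratteli) : Prop :=
  isolated [set: infpath B] = set0.

Definition aperiodic (B : bratteli) : Prop :=
  forall x : infpath B, infinite_set [set y | tail_equiv x y].

(* The vertex at level [n] of a path. *)
Definition vat (B : bratteli) n (x : infpath B) : V B n := src (x n).

(* Orders: a linear order on each fibre of [rng], edges with distinct ranges
    being incomparable *)

Record border (B : bratteli) := BOrder {
  ole : forall n, rel (E B n);
  ole_rng : forall n (e f : E B n), ole e f -> rng e = rng f;
  ole_refl : forall n, reflexive (@ole n);
  ole_anti : forall n, antisymmetric (@ole n);
  ole_trans : forall n, transitive (@ole n);
  ole_total : forall n (e f : E B n), rng e = rng f -> ole e f || ole f e }.

Section Order.
Variables (B : bratteli) (w : border B).

Definition olt n (e f : E B n) : bool := (e != f) && ole w e f.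

Definition emax n (e : E B n) : Prop := forall f, rng f = rng e -> ole w f e.
Definition emin n (e : E B n) : Prop := forall f, rng f = rng e -> ole w e f.

Definition esucc n (e f : E B n) : Prop :=
  olt e f /\ forall g, ~~ (olt e g && olt g f).

Definition Xmax : set (infpath B) := [set x | forall n, emax (x n)].
Definition Xmin : set (infpath B) := [set x | forall n, emin (x n)].

Definition fpath_lt (q p : seq (edge B)) : Prop :=
  exists q1 p1 n (f e : E B n) t,
    [/\ size q1 = size p1, q = q1 ++ edg f :: t, p = p1 ++ edg e :: t
      & olt f e].

(* [is_word v W]: W is the word w(v, n, N); a path from [V B n] to [v] is
   represented by its starting vertex and its edges. *)
Definition is_word n N (v : V B N) (W : seq (V B n)) : Prop :=
  exists ps : seq (V B n * seq (edge B)),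
    [/\ sorted (fun q p => `[< fpath_lt q.2 p.2 >]) ps,
        forall p, (p \in ps) = joins (vtx p.1) p.2 (vtx v)
      & W = [seq p.1 | p <- ps]].

Definition language n : set (seq (V B n)) :=
  [set u | exists N (v : V B N) W, [/\ (n < N)%N, is_word v W & infix u W]].

Definition Vmax n : set (V B n) := [set vat n M | M in Xmax].
Definition Vmin n : set (V B n) := [set vat n m | m in Xmin].

Definition well_telescoped : Prop :=
  [/\ forall n, (1 <= n)%N -> forall e : E B n, emax e -> Vmax (src e),
      forall n, (1 <= n)%N -> forall e : E B n, emin e -> Vmin (src e)
    & forall n (v : V B n.+1) (u : V B n), incid v u != 0 -> (2 <= incid v u)%N].

(* [sigma] is only meant for [v] in [Vmax n]. *)
Definition sigma n (v : V B n) : set (V B n) :=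
  [set u | Vmin u /\ language [:: v; u]].
Definition sigma_inv n (u : V B n) : set (V B n) :=
  [set v | Vmax v /\ sigma v u].

Definition homeomorphism (T : topologicalType) (f : T -> T) : Prop :=
  continuous f /\
  exists g : T -> T, [/\ cancel f g, cancel g f & continuous g].

Definition vershik_map (phi : infpath B -> infpath B) : Prop :=
  [/\ homeomorphism phi,
      phi @` Xmax = Xmin
    & forall (x : infpath B) k,
        (forall i, (i < k)%N -> emax (x i)) -> ~ emax (x k) ->
        [/\ forall i, (i < k)%N -> emin (phi x i),
            esucc (x k) (phi x k)
          & forall i, (k < i)%N -> phi x i = x i]].

Definition perfect : Prop := exists phi, vershik_map phi.

End Order.

Definition regular (B : bratteli) : Prop :=
  forall w : border B, interior (Xmax w) = set0 /\ interior (Xmin w) = set0.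

Definition OB (B : bratteli) (j : nat) : set (border B) :=
  [set w | (Xmax w #= `I_j)%card /\ (Xmin w #= `I_j)%card].

Definition PBstar (B : bratteli) : set (border B) :=
  [set w | [/\ perfect w, well_telescoped w,
    forall M, Xmax w M ->
      \forall n \near \oo, exists u, sigma w (vat n M) = [set u]
  & forall m, Xmin w m ->
      \forall n \near \oo, exists v, sigma_inv w (vat n m) = [set v]]].

Section DimensionGroup.
Variable B : bratteli.

Definition zvec n : zmodType := {ffun V B n -> int}.

Definition incid_map n (x : zvec n) : zvec n.+1 :=
  [ffun v => \sum_(w : V B n) (incid v w)%:Z * x w].

Lemma incid_map_is_additive n : zmod_morphism (@incid_map n).
Proof.
move=> x y; apply/ffunP => v; rewrite !ffunE -sumrB.
by apply: eq_bigr => w _; rewrite !ffunE mulrBr.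
Qed.

HB.instance Definition _ n :=
  GRing.isZmodMorphism.Build _ _ (@incid_map n) (@incid_map_is_additive n).

Definition dg_step (u : {n : nat & zvec n}) : {n : nat & zvec n} :=
  Tagged zvec (incid_map (tagged u)).

(* Two vectors, at possibly distinct levels, define the same class iff they
   have the same image at some further level. *)
Definition dg_rel (u v : {n : nat & zvec n}) : bool :=
  `[< exists i j, iter i dg_step u = iter j dg_step v >].

Lemma tag_iter_step i u : tag (iter i dg_step u) = (i + tag u)%N.
Proof. by elim: i => //= i ->. Qed.

Lemma dg_rel_refl : reflexive dg_rel.
Proof. by move=> u; apply/asboolP; exists 0%N, 0%N. Qed.

Lemma dg_rel_sym : symmetric dg_rel.
Proof.
by move=> u v; apply/asboolP/asboolP => -[i [j ij]]; exists j, i.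
Qed.

Lemma dg_rel_trans : transitive dg_rel.
Proof.
move=> v u w /asboolP[i [j uv]] /asboolP[k [l vw]]; apply/asboolP.
exists (k + i)%N, (j + l)%N.
by rewrite iterD uv -iterD addnC iterD vw -iterD.
Qed.

Canonical dg_equiv := EquivRel dg_rel dg_rel_refl dg_rel_sym dg_rel_trans.

Definition dimG := {eq_quot dg_rel}.

HB.instance Definition _ := Choice.on dimG.
HB.instance Definition _ := EqQuotient.on dimG.

Definition dg_in n (x : zvec n) : dimG := \pi_dimG (Tagged zvec x).

Lemma dg_inE n m (x : zvec n) (y : zvec m) :
  dg_in x = dg_in y <->
  exists i j, iter i dg_step (Tagged zvec x) = iter j dg_step (Tagged zvec y).
Proof.
split=> [/eqmodP/asboolP //|xy]; exact/eqmodP/asboolP.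
Qed.

Lemma dg_in_iter i u : \pi_dimG (iter i dg_step u) = \pi_dimG u.
Proof. by apply/eqmodP/asboolP; exists 0%N, i. Qed.

Lemma dg_in_incid n (x : zvec n) : dg_in (incid_map x) = dg_in x.
Proof. exact: (dg_in_iter 1 (Tagged zvec x)). Qed.

Lemma dg_in_level u N : (tag u <= N)%N -> exists x : zvec N, \pi_dimG u = dg_in x.
Proof.
move=> /subnK uN; have := tag_iter_step (N - tag u) u; rewrite uN.
case: (iter _ _ _) (dg_in_iter (N - tag u) u) => m x <- /= mN.
by case: N / mN {uN}; exists x.
Qed.

Lemma iter_stepD i n (x y : zvec n) : exists x' y' : zvec (i + n),
  [/\ iter i dg_step (Tagged zvec x) = Tagged zvec x',
      iter i dg_step (Tagged zvec y) = Tagged zvec y'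
    & iter i dg_step (Tagged zvec (x + y)) = Tagged zvec (x' + y')].
Proof.
elim: i => [|i [x' [y' [ix iy ixy]]]]; first by exists x, y.
exists (incid_map x'), (incid_map y'); rewrite !iterS ix iy ixy.
by split=> //; rewrite /dg_step /= raddfD.
Qed.

Lemma TaggedD n m (x y : zvec n) (x' y' : zvec m) :
  Tagged zvec x = Tagged zvec x' -> Tagged zvec y = Tagged zvec y' ->
  Tagged zvec (x + y) = Tagged zvec (x' + y').
Proof.
move=> xx'; have nm : n = m by exact: (congr1 tag xx').
case: m / nm x' y' xx' => x' y' /eqP; rewrite eq_Tagged /= => /eqP ->.
by move=> /eqP; rewrite eq_Tagged /= => /eqP ->.
Qed.

Lemma dg_in_congD n m (x y : zvec n) (x' y' : zvec m) :
  dg_in x = dg_in x' -> dg_in y = dg_in y' -> dg_in (x + y) = dg_in (x' + y').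
Proof.
move=> /dg_inE[i [j xx']] /dg_inE[k [l yy']]; apply/dg_inE.
have ijkl : (k + j = i + l)%N.
  move: (congr1 tag xx') (congr1 tag yy'); rewrite !tag_iter_step /= => h1 h2.
  apply: (@addIn (n + m)); rewrite [LHS]addnACA h2 -h1.
  by rewrite addnACA [(l + i)%N]addnC [(m + n)%N]addnC.
exists (k + i)%N, (k + j)%N.
have [x1 [y1 [ix iy ->]]] := iter_stepD (k + i) x y.
have [x2 [y2 [jx jy ->]]] := iter_stepD (k + j) x' y'.
apply: TaggedD; first by rewrite -ix -jx iterD xx' -iterD.
by rewrite -iy -jy addnC iterD yy' -iterD ijkl.
Qed.

(* Both arguments are pushed to the level [tag u + tag v]. *)
Definition dg_add_rep (u v : {n : nat & zvec n}) : {n : nat & zvec n} :=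
  let u' := iter (tag v) dg_step u in
  let v' := iter (tag u) dg_step v in
  Tagged zvec (tagged u' + tagged_as u' v').

Definition dg_zero : dimG := dg_in (0 : zvec 0).
Definition dg_add (g h : dimG) : dimG :=
  \pi_dimG (dg_add_rep (repr g) (repr h)).
Definition dg_opp (g : dimG) : dimG := dg_in (- tagged (repr g)).

Lemma dg_addE n (x y : zvec n) : dg_add (dg_in x) (dg_in y) = dg_in (x + y).
Proof.
rewrite /dg_add /dg_add_rep; set u := repr (dg_in x); set v := repr _.
have uv : tag (iter (tag u) dg_step v) = tag (iter (tag v) dg_step u).
  by rewrite !tag_iter_step addnC.
have ux : \pi_dimG (iter (tag v) dg_step u) = dg_in x.
  by rewrite dg_in_iter; exact: reprK.
have vy : \pi_dimG (iter (tag u) dg_step v) = dg_in y.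
  by rewrite dg_in_iter; exact: reprK.
case: (iter (tag u) _ _) uv vy => m b.
case: (iter (tag v) _ _) ux => m' a xa /= mm'.
by case: m' / mm' a xa => a xa yb; rewrite tagged_asE; exact: dg_in_congD.
Qed.

Lemma dg_in_eq0 n : dg_in (0 : zvec n) = dg_zero.
Proof.
have i0 i : iter i dg_step (Tagged zvec (0 : zvec 0)) =
    Tagged zvec (0 : zvec (i + 0)).
  by elim: i => //= i ->; rewrite /dg_step /= raddf0.
by apply/dg_inE; exists 0%N, n; rewrite i0 /= addn0.
Qed.

Lemma dg_oppE n (x : zvec n) : dg_opp (dg_in x) = dg_in (- x).
Proof.
rewrite /dg_opp; set u := repr _.
have : dg_in (tagged u) = dg_in x by rewrite /dg_in taggedK reprK.
move=> /dg_inE[i [j ij]]; apply/dg_inE; exists i, j; move: ij.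
have iN k m (y : zvec m) : exists y' : zvec (k + m),
    iter k dg_step (Tagged zvec y) = Tagged zvec y' /\
    iter k dg_step (Tagged zvec (- y)) = Tagged zvec (- y').
  elim: k => [|k [y' [ky kNy]]]; first by exists y.
  by exists (incid_map y'); rewrite !iterS ky kNy /dg_step /= raddfN.
have [a [-> ->]] := iN i _ (tagged u); have [b [-> ->]] := iN j _ x.
move=> ab; have abn : (i + tag u = j + n)%N by exact: (congr1 tag ab).
case: _ / abn b ab => b /eqP; rewrite eq_Tagged /= => /eqP -> //.
Qed.

Lemma dg_addA : associative dg_add.
Proof.
elim/quotW => u; elim/quotW => v; elim/quotW => w.
pose N := maxn (tag u) (maxn (tag v) (tag w)).
have [|x ->] := @dg_in_level u N; rewrite ?leq_max ?leqnn ?orbT//.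
have [|y ->] := @dg_in_level v N; rewrite ?leq_max ?leqnn ?orbT//.
have [|z ->] := @dg_in_level w N; rewrite ?leq_max ?leqnn ?orbT//.
by rewrite !dg_addE addrA.
Qed.

Lemma dg_addC : commutative dg_add.
Proof.
elim/quotW => u; elim/quotW => v; pose N := maxn (tag u) (tag v).
have [|x ->] := @dg_in_level u N; rewrite ?leq_max ?leqnn ?orbT//.
have [|y ->] := @dg_in_level v N; rewrite ?leq_max ?leqnn ?orbT//.
by rewrite !dg_addE addrC.
Qed.

Lemma dg_add0 : left_id dg_zero dg_add.
Proof.
elim/quotW => u; have [//|x ->] := @dg_in_level u (tag u).
by rewrite -(dg_in_eq0 (tag u)) dg_addE add0r.
Qed.

Lemma dg_addN : left_inverse dg_zero dg_opp dg_add.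
Proof.
elim/quotW => u; have [//|x ->] := @dg_in_level u (tag u).
by rewrite dg_oppE dg_addE addNr dg_in_eq0.
Qed.

HB.instance Definition _ :=
  GRing.isZmodule.Build dimG dg_addA dg_addC dg_add0 dg_addN.

Lemma dg_in_is_additive n : zmod_morphism (@dg_in n).
Proof. by move=> x y; rewrite -dg_addE -dg_oppE. Qed.

HB.instance Definition _ n :=
  GRing.isZmodMorphism.Build _ _ (@dg_in n) (@dg_in_is_additive n).

Definition dg_pos : set dimG :=
  [set g | exists n (x : zvec n), (forall v, 0 <= x v) /\ g = dg_in x].

Definition dg_unit : dimG := dg_in ([ffun=> 1] : zvec 0).

Definition normalized_trace (R : realType) (tau : {additive dimG -> R}) :=
  (forall g, dg_pos g -> 0 <= tau g) /\ tau dg_unit = 1.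

Definition Inf (R : realType) : set dimG :=
  [set g | forall tau : {additive dimG -> R},
     normalized_trace tau -> tau g = 0].

End DimensionGroup.

Arguments OB B j : clear implicits.
Arguments PBstar B : clear implicits.
Arguments Inf B R : clear implicits.

(* Main.v *)
(* For a maximal path M and n large, the pair (a, b) = (v_n(M), v_n(phi M)) is
   matched: in a two-letter word of L(B, omega, n) whose letters lie on a maximal
   and on a minimal path, the first letter is a iff the second one is b.  For
   K > n and v in V_K, let F_K(v) be 1 if the maximal path descending from v
   meets a, and 0 otherwise; let G_K(v) be the analogue for the minimal path and
   b.  For consecutive edges e < e' with the same range, F_K(s(e)) = G_K(s(e')),
   so the incidence map sends F_K - G_K to F_{K+1} - G_{K+1} by telescoping, and
   these vectors represent one element of G.  It is infinitesimal because its
   representatives stay bounded by 1, while a normalized trace gives the all-ones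
   vector of level K a value at most 2^-K.
   If an integer combination of such elements vanishes, the combinations F and G
   agree at all high levels, hence F(s(e)) = F(s(e')) for consecutive edges, and
   F is constant on the high levels by simplicity.  Since X_max is infinite and
   each V_n is finite, one finds recursively levels n_k and maximal paths M_k,
   M'_k which agree at level n_{k-1} but not at level n_k: evaluating F on M_k
   and M'_k shows that the k-th coefficient, if the last nonzero one, is zero. *)
From HB Require Import structures.
Require Import Defs.
From mathcomp Require Import all_boot all_order all_algebra.
From mathcomp Require Import all_classical all_reals all_analysis.
From mathcomp Require Import freeg.

Set Implicit Arguments.
Unset Strict Implicit.
Unset Printing Implicit Defensive.

Import Order.TTheory GRing.Theory Num.Theory.
Local Open Scope classical_set_scope.
Local Open Scope ring_scope.

(** * Consecutive edges *)

Section Fibre.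
Variables (B : bratteli) (w : border B).

Definition fibre n (v : V B n.+1) : seq (E B n) :=
  sort (@ole B w n) (enum [pred e | rng e == v]).

Lemma mem_fibre n (v : V B n.+1) e : (e \in fibre v) = (rng e == v).
Proof. by rewrite mem_sort mem_enum. Qed.

Lemma olt_trans n : transitive (@olt B w n).
Proof.
move=> f e g /andP[ef lef] /andP[fg lfg]; apply/andP; split; last first.
  exact: ole_trans lef lfg.
apply: contraNneq ef => eg; rewrite -eg in lfg.
by apply/eqP/(@ole_anti _ w); rewrite lef.
Qed.

Lemma olt_irr n (e : E B n) : olt w e e = false.
Proof. by rewrite /olt eqxx. Qed.

(** Sorting gives pairwise [ole], and the absence of repetitions makes it strict. *)
Lemma pairwise_fibre n (v : V B n.+1) : pairwise (@olt B w n) (fibre v).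
Proof.
rewrite -(sorted_pairwise (@olt_trans n)).
have srt : sorted (@ole B w n) (fibre v).
  apply: (@sort_sorted_in _ [pred e | rng e == v]) => [e f /eqP ev /eqP fv|].
    by apply: ole_total; rewrite ev.
  by apply/allP => e; rewrite mem_enum.
have := srt; rewrite (sorted_pairwise (@ole_trans _ w n)) => pw.
have := sort_uniq (@ole B w n) (enum [pred e | rng e == v]).
rewrite enum_uniq uniq_pairwise -/(fibre v) sorted_pairwise;
  last exact: olt_trans.
move=> /(conj pw) /andP; rewrite -pairwise_relI.
by apply: sub_pairwise => e f /andP[? ?]; apply/andP.
Qed.

Lemma fibre_neq0 n (v : V B n.+1) : exists e s, fibre v = e :: s.
Proof.
have [e ev] := rng_surj v; have := mem_fibre v e; rewrite ev eqxx.
by case: (fibre v) => // a s _; exists a, s.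
Qed.

Definition emaxat n (v : V B n.+1) : E B n :=
  last (projT1 (cid (rng_surj v))) (fibre v).
Definition eminat n (v : V B n.+1) : E B n :=
  head (projT1 (cid (rng_surj v))) (fibre v).

Lemma rng_emaxat n (v : V B n.+1) : rng (emaxat v) = v.
Proof.
apply/eqP; rewrite -mem_fibre /emaxat.
by have [e [s ->]] := fibre_neq0 v; rewrite /= mem_last.
Qed.

Lemma rng_eminat n (v : V B n.+1) : rng (eminat v) = v.
Proof.
apply/eqP; rewrite -mem_fibre /eminat.
by have [e [s ->]] := fibre_neq0 v; rewrite /= mem_head.
Qed.

Lemma emax_emaxat n (v : V B n.+1) : emax w (emaxat v).
Proof.
move=> f; rewrite rng_emaxat => /eqP; rewrite -mem_fibre /emaxat.
have := pairwise_fibre v; have [e [s ->]] := fibre_neq0 v.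
rewrite [last _ _]/=; case: (lastP s) => [|s' e'].
  by rewrite inE => _ /eqP->; exact: ole_refl.
rewrite last_rcons -rcons_cons -cats1 pairwise_cat mem_cat => /and3P[+ _ _].
move=> /allrelP lt /orP[fs|]; last by rewrite inE => /eqP->; exact: ole_refl.
by have /andP[] := lt f e' fs (mem_head _ _).
Qed.

Lemma emin_eminat n (v : V B n.+1) : emin w (eminat v).
Proof.
move=> f; rewrite rng_eminat => /eqP; rewrite -mem_fibre /eminat.
have := pairwise_fibre v; have [e [s ->]] := fibre_neq0 v.
rewrite /= inE => /andP[/allP lt _] /predU1P[->|/lt/andP[] //].
exact: ole_refl.
Qed.

Lemma emax_inj n (e f : E B n) : emax w e -> emax w f -> rng e = rng f -> e = f.
Proof. by move=> ee ff ef; apply: (@ole_anti _ w); rewrite ee// ff. Qed.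

Lemma emin_inj n (e f : E B n) : emin w e -> emin w f -> rng e = rng f -> e = f.
Proof. by move=> ee ff ef; apply: (@ole_anti _ w); rewrite ee// ff. Qed.

Lemma emaxat_rng n (e : E B n) : emax w e -> emaxat (rng e) = e.
Proof.
by move=> ee; apply: emax_inj; rewrite ?rng_emaxat//; exact: emax_emaxat.
Qed.

Lemma eminat_rng n (e : E B n) : emin w e -> eminat (rng e) = e.
Proof.
by move=> ee; apply: emin_inj; rewrite ?rng_eminat//; exact: emin_eminat.
Qed.

(** An edge strictly in between would have the same range, hence occur in the list, where strictness
    leaves it no position. *)
Lemma esucc_fibre n (v : V B n.+1) s1 s2 e e' :
  fibre v = s1 ++ e :: e' :: s2 -> esucc w e e'.
Proof.
move=> fv; have := pairwise_fibre v; rewrite fv pairwise_cat /=.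
move=> /and3P[/allrelP s1lt _ /and3P[/andP[ee' es2] e's2 _]].
split=> // g; apply/negP => /andP[eg ge'].
have : g \in fibre v.
  rewrite mem_fibre; have /andP[_ /ole_rng <-] := eg.
  by rewrite -mem_fibre fv mem_cat mem_head orbT.
rewrite fv mem_cat !inE => /or4P[gs1|/eqP ge|/eqP ge|gs2].
- have /(olt_trans eg) := s1lt g e gs1 (mem_head _ _).
  by rewrite olt_irr.
- by rewrite ge olt_irr in eg.
- by rewrite ge olt_irr in ge'.
- by have := olt_trans ge' (allP e's2 _ gs2); rewrite olt_irr.
Qed.

Lemma fibre_esucc n (e e' : E B n) : esucc w e e' ->
  exists s1 s2, fibre (rng e) = s1 ++ e :: e' :: s2.
Proof.
move=> [ee' nog]; have ef : e \in fibre (rng e) by rewrite mem_fibre.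
have e'f : e' \in fibre (rng e).
  by rewrite mem_fibre; have /andP[_ /ole_rng ->] := ee'.
have := pairwise_fibre (rng e); move: e'f.
case/splitPr: ef => s1 s2; rewrite mem_cat inE pairwise_cat /=.
move=> + /and3P[/allrelP s1lt _ /andP[es2 s2lt]].
move=> /or3P[e's1|/eqP e'e|].
- by have := olt_trans ee' (s1lt _ _ e's1 (mem_head _ _)); rewrite olt_irr.
- by rewrite e'e olt_irr in ee'.
case: s2 {s1lt} es2 s2lt => // x s2 /= /andP[ex _] /andP[/allP xs2 _].
rewrite inE => /predU1P[->|e's2]; first by exists s1, s2.
by have := nog x; rewrite ex (xs2 _ e's2).
Qed.

(** Along the increasing list, [F] at an edge cancels [G] at its successor; only the last [F] and
    the first [G] survive. *)
Lemma fibre_telescope (A : zmodType) n (v : V B n.+1) (F G : E B n -> A) :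
  (forall e e', esucc w e e' -> F e = G e') ->
  \sum_(e | rng e == v) (F e - G e) = F (emaxat v) - G (eminat v).
Proof.
move=> FG; rewrite -big_enum /= (perm_big (fibre v)) /=; last first.
  by rewrite perm_sym perm_sort.
rewrite /emaxat /eminat; have [e0 [s0 fv]] := fibre_neq0 v; rewrite fv /=.
have : exists s1, fibre v = s1 ++ e0 :: s0 by exists [::].
elim: s0 e0 {fv} => [|e1 s0 IH] e0 [s1 fv]; first by rewrite big_seq1.
rewrite big_cons IH; last by exists (rcons s1 e0); rewrite cat_rcons.
by rewrite (FG e0 e1 (esucc_fibre fv)) addrC addrA subrK.
Qed.

Lemma fibre_chain (A : Type) n (v : V B n.+1) (F : E B n -> A) :
  (forall e e', esucc w e e' -> F e = F e') ->
  forall e, rng e = v -> F e = F (emaxat v).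
Proof.
move=> Fs e /eqP; rewrite -mem_fibre /emaxat.
move=> ef; have [s1 [s2 fv]] : exists s1 s2, fibre v = s1 ++ e :: s2.
  by case/splitPr: ef => s1 s2; exists s1, s2.
rewrite fv last_cat /= => {ef}.
elim: s2 s1 e fv => //= e' s2 IH s1 e fv; rewrite (Fs e e' (esucc_fibre fv)).
by apply: (IH (rcons s1 e)); rewrite cat_rcons.
Qed.

End Fibre.

Lemma incid_mapE (B : bratteli) n (x : zvec B n) v :
  incid_map x v = \sum_(e | rng e == v) x (src e).
Proof.
rewrite ffunE (partition_big (@src B n) predT) //=; apply: eq_bigr => u _.
rewrite (eq_bigr (fun=> x u)) => [|e /andP[_ /eqP->] //].
by rewrite sumr_const -mulr_natl natz.
Qed.

(** * Words *)

Section Joins.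
Variable B : bratteli.

Lemma vtx_inj n : injective (@vtx B n).
Proof. by move=> u v /eqP; rewrite eq_Tagged => /eqP. Qed.

Lemma tag_joins (u v : vertex B) p :
  joins u p v -> (tag u + size p)%N = tag v.
Proof.
elim: p u => [|e p IH] u /=; first by move=> /eqP->; rewrite addn0.
by move=> /andP[/eqP<- /IH <-]; rewrite addSnnS.
Qed.

Lemma joins_rcons (u v : vertex B) p e :
  joins u (rcons p e) v = joins u p (esrc e) && (erng e == v).
Proof.
elim: p u => [|f p IH] u /=; first by rewrite eq_sym andbC eq_sym andbC.
by rewrite IH andbA.
Qed.

Lemma joins_rconsP n (u : vertex B) (v : V B n.+1) q :
  (tag u <= n)%N -> joins u q (vtx v) ->
  exists p (e : E B n),
    [/\ q = rcons p (edg e), rng e = v & joins u p (vtx (src e))].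
Proof.
move=> un; case/lastP: q => [/eqP uv|p [m e]].
  by move: un; rewrite uv /= ltnn.
rewrite joins_rcons => /andP[jp /eqP ev].
have mn : m = n by have := congr1 tag ev => /= -[].
case: n / mn v ev un => v /vtx_inj /= ev _.
by exists p, e; split.
Qed.

End Joins.

(** * Descending along chosen edges *)

Section Down.
Variables (B : bratteli) (c : forall k, V B k.+1 -> E B k).

(* The vertex at level [n] of the path which goes down from [v] along the edges
   chosen by [c]; junk value [vtx v] if the level of [v] is less than [n]. *)
Fixpoint descend n K : V B K -> vertex B :=
  if K is K'.+1 then
    fun v => if (n <= K')%N then descend n (src (c v)) else vtx v
  else fun v => vtx v.

Arguments descend n K v : simpl never.

Lemma descend_id n (v : V B n) : descend n v = vtx v.
Proof. by case: n v => //= n v; rewrite /descend ltnn. Qed.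

Lemma descendS n K (v : V B K.+1) : (n <= K)%N ->
  descend n v = descend n (src (c v)).
Proof. by rewrite {1}/descend => ->. Qed.

(** Level [n] is reached through an edge chosen by [c]. For extremal edges and [n > 0],
    well-telescopedness then puts the vertex in [Vmax] or [Vmin]. *)
Lemma descend_src n K (v : V B K) : (n < K)%N ->
  exists v' : V B n.+1,
    descend n.+1 v = vtx v' /\ descend n v = vtx (src (c v')).
Proof.
elim: K v => // K IH v; rewrite ltnS leq_eqVlt => /predU1P[nK|nK].
  by subst n; exists v; rewrite descend_id descendS// descend_id.
by rewrite !descendS// ?(ltnW nK)//; exact: IH.
Qed.

Lemma descend_infpath n K (x : infpath B) : (n <= K)%N ->
  (forall i, (n <= i < K)%N -> x i = c (rng (x i))) ->
  descend n (vat K x) = vtx (vat n x).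
Proof.
move=> /subnKC <-; elim: (K - n)%N => [|d IH] cx.
  by rewrite addn0 descend_id.
rewrite addnS descendS ?leq_addr// {1}/vat -pth_chain -cx ?leq_addr ?addnS//=.
by apply: IH => i /andP[ni iK]; apply: cx; rewrite ni addnS ltnS ltnW.
Qed.

End Down.

(** * Increasing lists of paths *)

Section Language.
Variables (B : bratteli) (w : border B).
Notation topedge := (@emaxat B w).
Notation botedge := (@eminat B w).
Notation plt n := (fun q p : V B n * seq (edge B) => `[< fpath_lt w q.2 p.2 >]).

(** The last edge is the most significant in the order on paths, so blocks taken in fibre order keep
    the list increasing. *)
Definition extend_paths n K (P : V B K -> seq (V B n * seq (edge B)))
    (v : V B K.+1) : seq (V B n * seq (edge B)) :=
  flatten [seq [seq (p.1, rcons p.2 (edg e)) | p <- P (src e)]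
          | e <- fibre w v].

(** Invariant of the recursion on levels. The third clause identifies the first and last letters of
    the word of [v] through the minimal and maximal descents. *)
Definition path_lists n K (P : V B K -> seq (V B n * seq (edge B))) :=
  forall v, [/\ pairwise (plt n) (P v),
    forall p, (p \in P v) = joins (vtx p.1) p.2 (vtx v)
  & exists p0 s, [/\ P v = p0 :: s, vtx p0.1 = descend botedge n v
    & vtx (last p0 s).1 = descend topedge n v]].

Lemma path_lists0 n : @path_lists n n (fun v => [:: (v, [::])]).
Proof.
move=> v; split=> //=.
  move=> q; rewrite inE; case: q => u [|e p].
    by rewrite xpair_eqE andbT /= eq_Tagged.
  rewrite xpair_eqE andbF.
  apply/esym/negP => up; have := @tag_joins B (vtx u) (vtx v) (e :: p) up.
  by move=> /= /eqP; rewrite -[X in _ == X]addn0 eqn_add2l.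
by exists (v, [::]), [::]; rewrite !descend_id.
Qed.

Lemma pairwise_extend_paths n K (P : V B K -> seq (V B n * seq (edge B))) v :
  path_lists P -> pairwise (plt n) (extend_paths P v).
Proof.
move=> Pl; rewrite /extend_paths; have := pairwise_fibre w v.
elim: (fibre w v) => //= e s IH /andP[/allP es ss].
rewrite pairwise_cat IH// andbT; apply/andP; split.
  apply/allrelP => x y /mapP[p pe ->{x}] /flattenP[z /mapP[f fs ->{z}]].
  move=> /mapP[q qf ->{y}]; apply/asboolP; exists p.2, q.2, K, e, f, [::].
  rewrite !cats1; split=> //; last exact: es.
  move: pe qf; have [_ -> _] := Pl (src e); have [_ -> _] := Pl (src f).
  move=> /tag_joins /= pK /tag_joins /= qK.
  by apply: (@addnI n); rewrite pK qK.
rewrite pairwise_map; have [+ _ _] := Pl (src e).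
apply: sub_pairwise => p q /asboolP[q1 [p1 [m [f [g [t [sz pE qE fg]]]]]]].
apply/asboolP; exists q1, p1, m, f, g, (rcons t (edg e)).
by rewrite /= pE qE !rcons_cat.
Qed.

Lemma path_lists_extend_paths n K (P : V B K -> seq (V B n * seq (edge B))) :
  (n <= K)%N -> path_lists P -> path_lists (extend_paths P).
Proof.
move=> nK Pl v; split; first exact: pairwise_extend_paths.
  move=> [u q]; apply/flatten_mapP/idP => /=.
    move=> [e]; rewrite mem_fibre => /eqP ev /mapP[p].
    have [_ -> _] := Pl (src e) => pe [-> ->].
    by rewrite joins_rcons pe -ev /= eqxx.
  move=> /(@joins_rconsP _ _ (vtx u) _ _ nK)[p [e [-> ev pe]]].
  exists e; first by rewrite mem_fibre ev.
  by apply/mapP; exists (u, p) => //; have [_ -> _] := Pl (src e).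
have [A exM] : exists A, extend_paths P v =
    A ++ [seq (p.1, rcons p.2 (edg (topedge v))) | p <- P (src (topedge v))].
  rewrite /extend_paths /emaxat; have [e [s ->]] := fibre_neq0 w v.
  rewrite [last _ _]/=; case: (lastP s) => [|s1 f].
    by exists [::]; rewrite /= cats0.
  rewrite last_rcons -rcons_cons -cats1 map_cat flatten_cat /= cats0.
  by eexists.
have [C exm] : exists C, extend_paths P v =
    [seq (p.1, rcons p.2 (edg (botedge v))) | p <- P (src (botedge v))] ++ C.
  by rewrite /extend_paths /eminat; have [e [s ->]] := fibre_neq0 w v; eexists.
have [_ _ [pm [sm [Pm pmE _]]]] := Pl (src (botedge v)).
have [_ _ [pM [sM [PM _ pME]]]] := Pl (src (topedge v)).
rewrite Pm /= in exm; rewrite PM in exM; rewrite exm.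
set p0 := (pm.1, _) in exm *; set s := _ ++ C in exm *.
exists p0, s; split=> //.
  by rewrite descendS.
rewrite descendS// -pME; have := congr1 (last pm) exM.
by rewrite exm /= last_cat /= last_map => ->.
Qed.

Lemma path_lists_exist n K : (n <= K)%N -> exists P, @path_lists n K P.
Proof.
elim: K => [|K IH].
  by rewrite leqn0 => /eqP->; eexists; exact: path_lists0.
rewrite leq_eqVlt => /predU1P[->|nK]; first by eexists; exact: path_lists0.
have [P Pl] := IH nK.
by exists (extend_paths P); exact: path_lists_extend_paths.
Qed.

(** In the word of [rng e], the block of [e] is directly followed by that of [e']; [a] ends the
    first and [b] begins the second. *)
Lemma language_esucc n K (e e' : E B K) : (n <= K)%N -> esucc w e e' ->
  exists a b : V B n, [/\ vtx a = descend topedge n (src e),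
    vtx b = descend botedge n (src e') & @language B w n [:: a; b]].
Proof.
move=> nK /fibre_esucc[s1 [s2 fv]]; have [P Pl] := path_lists_exist nK.
have [_ _ [pM [sM [PM _ pME]]]] := Pl (src e).
have [_ _ [pm [sm [Pm pmE _]]]] := Pl (src e').
exists (last pM sM).1, pm.1; split=> //.
exists K.+1, (rng e), [seq p.1 | p <- extend_paths P (rng e)]; split=> //.
  have [ps mem_ps _] := path_lists_extend_paths nK Pl (rng e).
  exists (extend_paths P (rng e)); split=> //; exact: pairwise_sorted.
rewrite /extend_paths fv map_cat flatten_cat /= PM Pm !map_cat -!map_comp /=.
set A := map _ _; set D := map _ (flatten _); set C := map _ sm.
apply/infixP; exists (A ++ belast pM.1 [seq p.1 | p <- sM]), (C ++ D).
rewrite -catA /=; congr (_ ++ _).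
rewrite -[RHS]cat_rcons -(last_map (fun p : V B n * seq (edge B) => p.1)).
by rewrite -lastI.
Qed.
End Language.

(** * Stable sequences in the dimension group *)

Section DimensionGroup.
Variables (B : bratteli) (y : forall K, zvec B K) (N : nat).
Hypothesis yS : forall K, (N <= K)%N -> incid_map (y K) = y K.+1.

Lemma dg_in_stable K : (N <= K)%N -> dg_in (y K) = dg_in (y N).
Proof.
move=> /subnK <-; elim: (K - N)%N => // d IH.
by rewrite addSn -yS ?leq_addl// dg_in_incid.
Qed.

(** A class vanishes in the limit only if some later image does, and the later images of [y N] are
    the [y K]. *)
Lemma dg_in_stable0 : dg_in (y N) = 0 ->
  exists2 K0, (N <= K0)%N & forall K, (K0 <= K)%N -> y K = 0.
Proof.
rewrite -[RHS](dg_in_eq0 B N) => /dg_inE[i [j ij]].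
have iterE k : iter k (@dg_step B) (Tagged (zvec B) (y N)) =
    Tagged (zvec B) (y (k + N)).
  by elim: k => //= k ->; rewrite /dg_step /= yS ?leq_addl.
have iter0 k : iter k (@dg_step B) (Tagged (zvec B) (0 : zvec B N)) =
    Tagged (zvec B) (0 : zvec B (k + N)).
  by elim: k => //= k ->; rewrite /dg_step /= raddf0.
exists (i + N)%N; first exact: leq_addl.
have y0 : y (i + N) = 0.
  move: ij; rewrite iterE iter0 => ij.
  have /addIn ji : (j + N = i + N)%N by have := congr1 tag ij.
  by move: ij; rewrite ji => /eqP; rewrite eq_Tagged => /eqP.
move=> K /subnK <-; elim: (K - _)%N => // d IH.
by rewrite addSn -yS ?IH ?raddf0// addnA leq_addl.
Qed.

End DimensionGroup.

(** * Bounded stable sequences are infinitesimal *)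

Section Infinitesimal.
Variables (R : realType) (B : bratteli).
Hypothesis incid_ge2 :
  forall n (v : V B n.+1) (u : V B n), incid v u != 0 -> (2 <= incid v u)%N.

Let ones K : zvec B K := [ffun=> 1].

Lemma trace_le (tau : {additive dimG B -> R}) K (x z : zvec B K) :
  normalized_trace tau -> (forall v, x v <= z v) ->
  tau (dg_in x) <= tau (dg_in z).
Proof.
move=> [tau_ge0 _] xz; rewrite -subr_ge0 -!raddfB; apply: tau_ge0.
by exists K, (z - x); split=> // v; rewrite !ffunE subr_ge0.
Qed.

(** Every vertex receives an edge, hence at least two from one source: the image of [ones K]
    dominates twice [ones K.+1]. *)
Lemma trace_ones (tau : {additive dimG B -> R}) K :
  normalized_trace tau -> tau (dg_in (ones K)) *+ 2 ^ K <= 1.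
Proof.
move=> tauP; elim: K => [|K IH]; first by have [_ <-] := tauP; rewrite mulr1n.
apply: le_trans IH; rewrite expnS mulrnA ler_wMn2r// -!raddfMn /=.
rewrite -[leRHS](congr1 tau (dg_in_incid _)); apply: trace_le => // v.
rewrite !ffunE; have [e ev] := rng_surj v.
rewrite (bigD1 (src e))//= !ffunE mulr1 -[leLHS]addr0 lerD//; last first.
  by apply: sumr_ge0 => u _; rewrite ffunE mulr1.
rewrite lez_nat; apply: incid_ge2; rewrite -lt0n; apply/card_gt0P.
by exists e; rewrite inE ev !eqxx.
Qed.

(** The trace has the same value on all [y K] with [K >= N], and that of [ones K], at most [2^-K],
    bounds it. *)
Lemma bounded_Inf (y : forall K, zvec B K) N :
  (forall K, (N <= K)%N -> incid_map (y K) = y K.+1) ->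
  (forall K v, `|y K v| <= 1) -> Inf B R (dg_in (y N)).
Proof.
move=> yS y1 tau tauP; apply/eqP; rewrite -normr_eq0 -[_ == _]negbK.
apply/negP => t0; set t := `|_| in t0.
have {}t0 : 0 < t by rewrite lt_def t0 normr_ge0.
have t_le K : (N <= K)%N -> t *+ 2 ^ K <= 1.
  move=> NK; apply: le_trans (trace_ones K tauP); rewrite ler_wMn2r//.
  rewrite /t -(dg_in_stable yS NK) ler_norml -!raddfN /=.
  by apply/andP; split; apply: trace_le => // v; rewrite !ffunE;
    have := y1 K v; rewrite ler_norml => /andP[].
have := t_le (maxn N (Num.bound t^-1)) (leq_maxl _ _).
apply/negP; rewrite -ltNge -mulr_natr -ltr_pdivrMl// mulr1.
apply: lt_le_trans (archi_boundP _) _; first by rewrite invr_ge0 ltW.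
rewrite ler_nat; apply: leq_trans (leq_maxr N _) _.
exact: ltnW (ltn_expl _ _).
Qed.

End Infinitesimal.

Lemma vertex_exists (B : bratteli) K : inhabited (V B K).
Proof.
elim: K => [|K [v]]; last by have [e _] := src_surj v; exists; exact: rng e.
have /card_gt0P[v _] : (0 < #|V B 0|)%N by rewrite card_V0.
by exists.
Qed.

(** [F] is constant along paths, and simplicity joins any two vertices of level [N] to a common
    later vertex. *)
Lemma simple_const (B : bratteli) (A : Type) (F : forall K, V B K -> A) N :
  simple_bratteli B ->
  (forall K, (N <= K)%N -> forall e : E B K, F _ (src e) = F _ (rng e)) ->
  forall u v : V B N, F N u = F N v.
Proof.
move=> /(_ N)[m Nm sB] Fe; have Fj p : forall x z : vertex B,
    (N <= tag x)%N -> joins x p z -> F _ (tagged x) = F _ (tagged z).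
  elim: p => [|e p IH] x z Nx /=; first by move=> /eqP->.
  case/andP => /eqP ex; rewrite -ex in Nx *.
  by move=> /IH <-; [exact: Fe|exact: leqW].
have [w] := vertex_exists B m; move=> u v.
have [p /Fj up] := sB u w; have [q /Fj vq] := sB v w.
by have := up (leqnn N); have := vq (leqnn N) => /= -> ->.
Qed.

(** * Matched pairs *)

Section PathSpace.
Variable B : bratteli.

Lemma open_cylinder (x : infpath B) n : open (cylinder x n).
Proof.
exists [set cylinder x n]; last by rewrite bigcup_set1.
by move=> _ ->; exists x, n.
Qed.

Lemma nbhs_cylinder (x : infpath B) (A : set (infpath B)) :
  nbhs x A -> exists n, cylinder x n `<=` A.
Proof.
rewrite nbhsE => -[U [[D Dcyl <-] [C DC Cx]] UA].
have [z [n Cz]] := Dcyl _ DC; exists n => t xt; apply: UA; exists C => //.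
by move: Cx; rewrite Cz /= => zx i ni; rewrite xt// zx.
Qed.

Lemma cylinder_nbhs (x : infpath B) n : nbhs x (cylinder x n).
Proof. by apply: open_nbhs_nbhs; split; first exact: open_cylinder. Qed.

Lemma infpath_eq (x y : infpath B) : (forall n, x n = y n) -> x = y.
Proof.
case: x y => [x xc] [y yc] /= xy.
have {}xy : x = y by apply/functional_extensionality_dep.
by case: y / xy yc => yc; congr InfPath; exact: Prop_irrelevance.
Qed.

End PathSpace.

Section Maximal.
Variables (B : bratteli) (w : border B).

(** Going down from the common vertex, only one maximal edge is available at each step. *)
Lemma vat_max_inj n (x y : infpath B) : Xmax w x -> Xmax w y ->
  vat n x = vat n y -> forall i, (i < n)%N -> x i = y i.
Proof.
move=> xM yM; elim: n => // n IH xy.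
have xyn : x n = y n.
  by apply: (emax_inj (xM n) (yM n)); rewrite !pth_chain.
move=> i; rewrite ltnS leq_eqVlt => /predU1P[->//|]; apply: IH.
by rewrite /vat xyn.
Qed.

Lemma vat_max_leq n m (x y : infpath B) : Xmax w x -> Xmax w y ->
  (n <= m)%N -> vat m x = vat m y -> vat n x = vat n y.
Proof.
move=> xM yM; rewrite leq_eqVlt => /predU1P[->//|nm] xy.
by rewrite /vat (vat_max_inj xM yM xy nm).
Qed.

Lemma vat_max_sep (x y : infpath B) : Xmax w x -> Xmax w y -> x != y ->
  exists N, forall n, (N <= n)%N -> vat n x != vat n y.
Proof.
move=> xM yM xy; have [i xyi] : exists i, x i != y i.
  apply: contrapT => xyE; move/eqP: xy; apply; apply: infpath_eq => i.
  by apply: contrapT => /eqP xyi; apply: xyE; exists i.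
exists i.+1 => n ni; apply: contraNneq xyi.
by move=> /(vat_max_inj xM yM) ->.
Qed.

(** Otherwise the vertex at level [n] would embed [Xmax] in the finite set [V B n]. *)
Lemma vat_max_pigeonhole n : infinite_set (Xmax w) ->
  exists x y, [/\ Xmax w x, Xmax w y, vat n x = vat n y & x != y].
Proof.
move=> infM; apply: contrapT => nxy; apply: infM.
have vinj : {in Xmax w &, injective (@vat B n)}.
  move=> x y /set_mem xM /set_mem yM xy; apply: contrapT => /eqP nexy.
  by apply: nxy; exists x, y.
by rewrite -(eq_finite_set (inj_card_eq vinj)); exact: finite_finset.
Qed.

Lemma descend_emax n K (x : infpath B) : (n <= K)%N ->
  (forall i, (n <= i < K)%N -> emax w (x i)) ->
  descend (@emaxat B w) n (vat K x) = vtx (vat n x).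
Proof. by move=> nK xM; apply: descend_infpath => // i /xM /emaxat_rng. Qed.

Lemma descend_emin n K (x : infpath B) : (n <= K)%N ->
  (forall i, (n <= i < K)%N -> emin w (x i)) ->
  descend (@eminat B w) n (vat K x) = vtx (vat n x).
Proof. by move=> nK xM; apply: descend_infpath => // i /xM /eminat_rng. Qed.

(* The path [M] is a limit of non-maximal paths [x]; for [x] close to [M], the
   vertices at level [n] of [x] and [phi x] are adjacent in a word. *)
Lemma sigma_vershik phi (M : infpath B) n : vershik_map w phi ->
  interior (Xmax w) = set0 -> Xmax w M -> sigma w (vat n M) (vat n (phi M)).
Proof.
move=> [[phi_cts _] phiX phiE] noint XM.
split; first by exists (phi M) => //; rewrite -phiX; exists M.
have [j cj] := nbhs_cylinder (phi_cts M _ (cylinder_nbhs (phi M) n.+1)).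
(* [j] makes [phi x] follow [phi M] through edge [n], whose source is the vertex at level [n];
   [n.+1] does the same for [x] and [M]. *)
pose J := maxn j n.+1.
have [x Mx nX] : exists2 x, cylinder M J x & ~ Xmax w x.
  apply: contrapT => noX; suff : interior (Xmax w) M by rewrite noint.
  apply: filterS (cylinder_nbhs M J) => x Mx; apply: contrapT => nX.
  by apply: noX; exists x.
have [k nk kE] : exists2 k, ~ emax w (x k) &
    forall i, (i < k)%N -> emax w (x i).
  have exk : exists k, `[< ~ emax w (x k) >].
    by move/existsNP: nX => [k xk]; exists k; apply/asboolP.
  exists (ex_minn exk); case: ex_minnP => k /asboolP // xk kmin.
  by move=> i ik; apply: contrapT => /asboolP/kmin; rewrite leqNgt ik.
have Jk : (J <= k)%N.
  by rewrite leqNgt; apply/negP => kJ; apply: nk; rewrite Mx.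
have nJ : (n < J)%N by rewrite leq_max leqnn orbT.
have [phimin phisucc _] := phiE x k kE nk.
have nk' : (n <= k)%N by rewrite ltnW// (leq_trans nJ).
(* Below [k] the path [x] is maximal and [phi x] minimal, so the two descents follow these paths. *)
have [a [b [aE bE ab]]] := language_esucc nk' phisucc.
have phix : phi x n = phi M n.
  by apply: (cj x) => // i ij; apply: Mx; rewrite leq_max ij.
rewrite descend_emax// in aE; last by move=> i /andP[_]; exact: kE.
rewrite descend_emin// in bE; last by move=> i /andP[_]; exact: phimin.
by move: ab; rewrite (vtx_inj aE) (vtx_inj bE) /vat Mx// phix.
Qed.

Definition matched n (a b : V B n) := forall a' b' : V B n,
  Vmax w a' -> Vmin w b' -> language w [:: a'; b'] -> (a' == a) = (b' == b).

(** Take for [b] the vertex of [phi M]. By [sigma_vershik] it determines both singletons, and each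
    singleton gives one direction of the equivalence. *)
Lemma matched_near M : regular B -> PBstar B w -> Xmax w M ->
  exists N, forall n, (N <= n)%N -> exists b, matched (vat n M) b.
Proof.
move=> /(_ w)[noint _] [[phi phiV] _ sM sm] XM.
have [_ phiX _] := phiV.
have Xm : Xmin w (phi M) by rewrite -phiX; exists M.
have [N1 _ HN1] := sM M XM; have [N2 _ HN2] := sm _ Xm.
exists (maxn N1 N2) => n; rewrite geq_max => /andP[/HN1[u sE] /HN2[v siE]].
have Mm := @sigma_vershik phi M n phiV noint XM.
have uE : u = vat n (phi M) by move: (Mm); rewrite sE.
have vE : v = vat n M.
  have : sigma_inv w (vat n (phi M)) (vat n M) by split=> //; exists M.
  by rewrite siE.
exists (vat n (phi M)) => a' b' a'M b'm ab; apply/eqP/eqP => [a'E|b'E].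
  have : sigma w (vat n M) b' by rewrite -a'E.
  by rewrite sE uE.
have : sigma_inv w (vat n (phi M)) a' by split=> //; rewrite -b'E.
by rewrite siE vE.
Qed.

(** A Vershik map is injective and carries [Xmax] onto [Xmin], so a finite [Xmax] would force equal
    finite cardinals. *)
Lemma Xmax_infinite : PBstar B w ->
  ~ (\bigcup_(j in [set j | (1 <= j)%N]) OB B j) w -> infinite_set (Xmax w).
Proof.
move=> [[phi [[_ [psi [phiK _ _]]] phiX _]] [wtM _ _] _ _] nOB [j Xj].
apply: nOB; exists j; last first.
  split=> //; rewrite -phiX; apply: card_eq_trans Xj; apply: inj_card_eq.
  by move=> x y _ _; exact: (can_inj phiK).
(* The case [j = 0] is excluded: well-telescopedness, which starts at level 1, gives a maximal path
   through the source of a maximal edge into level 2. *)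
rewrite /= lt0n; apply/eqP => j0; rewrite j0 II0 in Xj.
have [v] := vertex_exists B 2.
have [M XM _] := wtM 1%N isT _ (@emax_emaxat B w _ v).
by move: Xj; rewrite card_eq0 => /eqP Xj; move: XM; rewrite Xj.
Qed.

(** * The infinitesimal of a matched pair *)

Section WellTelescoped.
Hypothesis wt : well_telescoped w.

(** This is [F_K - G_K]; at levels below [n] the junk value of [descend] makes it zero. *)
Definition sepvec n (a b : V B n) K : zvec B K :=
  [ffun v => (descend (@emaxat B w) n v == vtx a)%:R
             - (descend (@eminat B w) n v == vtx b)%:R].

(** As [n < K], the vertices reached at level [n] are sources of extremal edges, so [matched]
    applies to them. *)
Lemma matched_esucc n (a b : V B n) K (e e' : E B K) :
  (0 < n)%N -> matched a b -> (n < K)%N -> esucc w e e' ->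
  (descend (@emaxat B w) n (src e) == vtx a)
  = (descend (@eminat B w) n (src e') == vtx b).
Proof.
move=> n0 ab nK ee'; have [wtM wtm _] := wt.
have [a' [b' [a'E b'E lab]]] := language_esucc (ltnW nK) ee'.
rewrite -a'E -b'E !eq_Tagged /=; apply: ab => //.
  have [v [_]] := descend_src (@emaxat B w) (src e) nK.
  by rewrite -a'E => /vtx_inj ->; apply: wtM => //; exact: emax_emaxat.
have [v [_]] := descend_src (@eminat B w) (src e') nK.
by rewrite -b'E => /vtx_inj ->; apply: wtm => //; exact: emin_eminat.
Qed.

Lemma incid_map_sepvec n (a b : V B n) K : (0 < n)%N -> matched a b ->
  (n < K)%N -> incid_map (sepvec a b K) = sepvec a b K.+1.
Proof.
move=> n0 ab nK; apply/ffunP => v; rewrite incid_mapE ffunE !descendS 1?ltnW//.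
under eq_bigr do rewrite ffunE.
apply: (@fibre_telescope _ w _ _ _
  (fun e => (descend (@emaxat B w) n (src e) == vtx a)%:R)
  (fun e => (descend (@eminat B w) n (src e) == vtx b)%:R)) => e e' ee'.
by rewrite (matched_esucc n0 ab nK ee').
Qed.

Lemma sepvec_Inf (R : realType) n (a b : V B n) : (0 < n)%N -> matched a b ->
  Inf B R (dg_in (sepvec a b n.+1)).
Proof.
move=> n0 ab; apply: bounded_Inf.
- by have [_ _] := wt.
- by move=> K nK; exact: incid_map_sepvec.
- by move=> K v; rewrite ffunE; case: (_ == _); case: (_ == _).
Qed.

End WellTelescoped.
End Maximal.

(** * Linear independence *)

Lemma ffunMzE (I : finType) (A : zmodType) (f : {ffun I -> A}) (m : int) i :
  (f *~ m) i = f i *~ m.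
Proof. by case: m => m; rewrite ?NegzE ?mulrNz ?ffunE -!pmulrn ffunMnE. Qed.

Section Independence.
Variables (B : bratteli) (w : border B).
Hypotheses (wt : well_telescoped w) (B_simple : simple_bratteli B).
Variables (n : nat -> nat) (a b : forall i, V B (n i)).
Variables (x y : nat -> infpath B).
Hypothesis n_gt0 : forall i, (0 < n i)%N.
Hypothesis n_incr : {homo n : i j / (i < j)%N}.
Hypothesis abP : forall i, matched w (a i) (b i).
Hypotheses (xM : forall i, Xmax w (x i)) (yM : forall i, Xmax w (y i)).
Hypothesis xa : forall i, vat (n i) (x i) = a i.
Hypothesis ya : forall i, vat (n i) (y i) != a i.
Hypothesis xy : forall i j, (i < j)%N -> vat (n i) (x j) = vat (n i) (y j).

(** Let [k] be the last index with nonzero coefficient. Since [x k] and [y k] agree at the levels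
    [n i] with [i < k], the combined [F] could distinguish them only by its term [k]. *)
Lemma sepvec_free (s : seq nat) (c : nat -> int) : uniq s ->
  \sum_(i <- s) dg_in (sepvec w (a i) (b i) (n i).+1) *~ c i = 0 ->
  {in s, forall i, c i = 0}.
Proof.
move=> us s0; apply: contrapT => nc0.
have exk : exists k, (k \in s) && (c k != 0).
  apply: contrapT => nex; apply: nc0 => i si; apply: contrapT => /eqP ci.
  by apply: nex; exists i; rewrite si.
have ubk k : (k \in s) && (c k != 0) -> (k <= \max_(i <- s) i)%N.
  by move=> /andP[ks _]; rewrite (big_rem k)//= leq_maxl.
have [k /andP[ks ck] kmax] := ex_maxnP exk ubk.
have n_le i : (i <= k)%N -> (n i <= n k)%N.
  by rewrite leq_eqVlt => /predU1P[->//|/n_incr/ltnW].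
pose F K (v : V B K) : int :=
  \sum_(i <- s) (descend (@emaxat B w) (n i) v == vtx (a i))%:R *~ c i.
pose G K (v : V B K) : int :=
  \sum_(i <- s) (descend (@eminat B w) (n i) v == vtx (b i))%:R *~ c i.
pose Y K : zvec B K := \sum_(i <- s) sepvec w (a i) (b i) K *~ c i.
have YE K v : Y K v = F K v - G K v.
  rewrite /Y sum_ffunE -sumrB; apply: eq_bigr => i _.
  by rewrite ffunMzE ffunE mulrzBl.
have small i : i \in s -> c i != 0 -> (i <= k)%N.
  by move=> si ci; apply: kmax; rewrite si.
have YS K : ((n k).+1 <= K)%N -> incid_map (Y K) = Y K.+1.
  move=> nK; rewrite /Y raddf_sum; apply: eq_big_seq => i si.
  rewrite raddfMz; have [->|ci] := eqVneq (c i) 0; first by rewrite !mulr0z.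
  rewrite /= incid_map_sepvec//; apply: leq_ltn_trans nK.
  by rewrite n_le// small.
have Y0 : dg_in (Y (n k).+1) = 0.
  rewrite -s0 /Y raddf_sum; apply: eq_big_seq => i si.
  rewrite raddfMz; have [->|ci] := eqVneq (c i) 0; first by rewrite !mulr0z.
  congr (_ *~ _); apply: (dg_in_stable (y := sepvec w (a i) (b i))).
    by move=> K nK; exact: incid_map_sepvec.
  by rewrite ltnS n_le// small.
have [K0 nK0 YK] := dg_in_stable0 YS Y0.
have FG K v : (K0 <= K)%N -> F K v = G K v.
  by move=> K0K; apply/eqP; rewrite -subr_eq0 -YE YK// ffunE.
(* Matching gives [F (src e) = G (src e')], and [F = G] from [K0] on. *)
have Fsucc K (e e' : E B K) : (K0 <= K)%N -> esucc w e e' ->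
    F K (src e) = F K (src e').
  move=> K0K ee'; rewrite [RHS]FG//; apply: eq_big_seq => i si.
  have [->|ci] := eqVneq (c i) 0; first by rewrite !mulr0z.
  rewrite (matched_esucc wt (n_gt0 i) (abP (i := i)) _ ee')//.
  by apply: leq_trans K0K; apply: leq_trans nK0; rewrite ltnS n_le// small.
have Fconst := @simple_const B _ F K0 B_simple _ (vat K0 (x k)) (vat K0 (y k)).
have {}Fconst : F K0 (vat K0 (x k)) = F K0 (vat K0 (y k)).
  apply: Fconst => K K0K e.
  (* All edges into a vertex give the same value, and the maximal descent from this vertex begins
     with the largest of them. *)
  rewrite (fibre_chain (fun e e' => @Fsucc K e e' K0K) (erefl (rng e))).
  apply: eq_big_seq => i si.
  have [->|ci] := eqVneq (c i) 0; first by rewrite !mulr0z.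
  rewrite [in RHS]descendS//; apply: leq_trans K0K; apply: leq_trans nK0.
  by rewrite leqW// n_le// small.
have xE i : (i <= k)%N -> descend (@emaxat B w) (n i) (vat K0 (x k)) =
    vtx (vat (n i) (x k)).
  move=> /n_le ik; apply: descend_emax => [|m _]; last exact: xM.
  by apply: leq_trans nK0; exact: leqW.
have yE i : (i <= k)%N -> descend (@emaxat B w) (n i) (vat K0 (y k)) =
    vtx (vat (n i) (y k)).
  move=> /n_le ik; apply: descend_emax => [|m _]; last exact: yM.
  by apply: leq_trans nK0; exact: leqW.
(* The term [k] is [c k] on [x k] and zero on [y k]; earlier terms coincide and later ones have
   coefficient zero. *)
move: Fconst; rewrite /F !(bigD1_seq k ks us)/= xE// yE// xa eqxx.
rewrite eq_Tagged /= (negbTE (ya k)) mul0rz add0r => Fconst.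
move/eqP: ck; apply; rewrite -[c k]intz; move: Fconst.
rewrite [in RHS]big_seq_cond [in LHS]big_seq_cond.
rewrite (eq_bigr (fun i => (descend (@emaxat B w) (n i) (vat K0 (y k)) ==
    vtx (a i))%:R *~ c i)).
  by rewrite -[RHS]add0r => /addIr.
move=> i /andP[si ik]; have [->|ci] := eqVneq (c i) 0; first by rewrite !mulr0z.
have ki := small _ si ci.
by rewrite xE// yE// xy// ltn_neqAle ik.
Qed.
End Independence.

(** * Homomorphisms from the free abelian group *)

Section FreeSubgroup.
Variables (M : zmodType) (g : nat -> M).

Definition freeg_lift (D : {freeg nat}) : M :=
  fglift (g : nat -> zmodule M) D.

Lemma freeg_lift_is_additive : zmod_morphism freeg_lift.
Proof. exact: (@lift_is_additive _ _ (zmodule M) g). Qed.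

HB.instance Definition _ :=
  GRing.isZmodMorphism.Build _ _ freeg_lift freeg_lift_is_additive.

Lemma freeg_liftE D : freeg_lift D = \sum_(i <- dom D) g i *~ coeff i D.
Proof.
by rewrite /freeg_lift -{1}(Freeg_dom D) fglift_Freeg /prelift big_map.
Qed.

(** A kernel element has coefficient zero on its whole support, so the support is empty. *)
Lemma freeg_lift_inj :
  (forall (s : seq nat) (c : nat -> int), uniq s ->
    \sum_(i <- s) g i *~ c i = 0 -> {in s, forall i, c i = 0}) ->
  injective freeg_lift.
Proof.
move=> free; apply: raddf_inj => D; rewrite /= freeg_liftE.
move=> /(free _ _ (uniq_dom D)) D0; apply/eqP; rewrite -dom_eq0.
case E : (dom D) => [//|i s]; have iD : i \in dom D by rewrite E mem_head.
by have := iD; rewrite mem_dom D0// eqxx.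
Qed.

End FreeSubgroup.

(** Packs a level with data depending on it, so that [choice] yields a single function of [N]. *)
Record splitting (B : bratteli) := Splitting {
  sp_level : nat;
  sp_max : V B sp_level;
  sp_min : V B sp_level;
  sp_left : infpath B;
  sp_right : infpath B }.

(** Two distinct maximal paths meet at level [N] by pigeonhole; any level beyond [N], their
    separation and the start of matching for the first one serves. *)
Lemma splitting_exists (B : bratteli) (w : border B) N :
  regular B -> PBstar B w -> infinite_set (Xmax w) ->
  exists t : splitting B,
    [/\ (N < sp_level t)%N, matched w (sp_max t) (sp_min t), Xmax w (sp_left t)
      & Xmax w (sp_right t)]
    /\ [/\ vat N (sp_left t) = vat N (sp_right t),
      vat (sp_level t) (sp_left t) = sp_max t
    & vat (sp_level t) (sp_right t) != sp_max t].
Proof.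
move=> B_regular wP infM.
have [x [y [xM yM xy nexy]]] := vat_max_pigeonhole N infM.
have [N1 HN1] := matched_near B_regular wP xM.
have [N2 HN2] := vat_max_sep xM yM nexy.
pose n := maxn N.+1 (maxn N1 N2).
have [|b xb] := HN1 n; first by rewrite /n !leq_max leqnn orbT.
exists (@Splitting B n (vat n x) b x y); do 2 split=> //=.
  by rewrite leq_max leqnn.
by rewrite eq_sym HN2// /n !leq_max leqnn !orbT.
Qed.

Theorem theorem5p5 (R : realType) (B : bratteli)
    (B_no_isolated : no_isolated_path B)
    (B_aperiodic : aperiodic B)
    (B_regular : regular B)
    (B_simple : simple_bratteli B)
    (omega : border B)
    (omegaP : (PBstar B `\` \bigcup_(j in [set j | (1 <= j)%N]) OB B j) omega) :
  exists f : {additive {freeg nat} -> dimG B},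
    injective f /\ range f `<=` Inf B R.
Proof.
have [wP nOB] := omegaP; have [_ wt _ _] := wP.
have infM := Xmax_infinite wP nOB.
have [T TP] := choice (fun N => splitting_exists N B_regular wP infM).
(* Each splitting starts from the level at which the previous one separates its paths. *)
pose l := fix l i := if i is i'.+1 then sp_level (T (l i')) else 0%N.
have l_lt i : (l i < l i.+1)%N by have [[]] := TP (l i).
have l_incr : {homo l : i j / (i < j)%N} by exact: homo_ltn ltn_trans l_lt.
pose n i := l i.+1.
pose a i : V B (n i) := sp_max (T (l i)).
pose b i : V B (n i) := sp_min (T (l i)).
have ab i : matched omega (a i) (b i) by have [[]] := TP (l i).
pose g i := dg_in (sepvec omega (a i) (b i) (n i).+1).
have n_gt0 i : (0 < n i)%N by exact: leq_ltn_trans (l_lt i).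
exists (freeg_lift g); split.
  apply: freeg_lift_inj; apply: (@sepvec_free _ _ wt B_simple n a b
    (fun i => sp_left (T (l i))) (fun i => sp_right (T (l i)))) => //.
  - by move=> i j ij; apply: l_incr.
  - by move=> i; have [[]] := TP (l i).
  - by move=> i; have [[]] := TP (l i).
  - by move=> i; have [_ []] := TP (l i).
  - by move=> i; have [_ []] := TP (l i).
  (* The paths agree at level [l j], and maximality carries this down to [n i <= l j]. *)
  move=> i j ij; have [[_ _ xM yM] [xy _ _]] := TP (l j).
  apply: (vat_max_leq xM yM _ xy); rewrite /n.
  by move: ij; rewrite leq_eqVlt => /predU1P[->//|/l_incr/ltnW].
move=> _ [D _ <-]; rewrite /= freeg_liftE => tau tauP.
rewrite raddf_sum big1// => i _.
by rewrite raddfMz (sepvec_Inf wt (n_gt0 i) (ab i) tauP) mul0rz.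
Qed.
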